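(* Let $X$ be a triple-double K3 surface, and let $X_3\to\mathbb{P}^2$ be the corresponding $\mathbb{Z}_2^3$-cover branched along the three pairs of lines $(\ell_0,\ell_1),(\ell_2,\ell_3),(\ell_4,\ell_5)$ (so that $X$ is the minimal resolution of $X_3$). Let $Y$ be the Hirzebruch-Kummer covering of exponent $2$ of $\mathbb{P}^2$ branched along $\ell_0,\ldots,\ell_5$. Consider the symplectic action on $Y$ of the group $\{\mathrm{id}_Y,\iota_{01},\iota_{23},\iota_{45}\}\cong\mathbb{Z}_2^2$. Then $X$ is isomorphic to the minimal resolution of $Y/\mathbb{Z}_2^2$.
   Context: Everything is over $\mathbb{C}$; $\mathbb{Z}_2=\mathbb{Z}/2\mathbb{Z}$. Let $\ell_0,\ldots,\ell_5$ be six lines in $\mathbb{P}^2$ without triple intersection points, divided into the pairs $(\ell_0,\ell_1),(\ell_2,\ell_3),(\ell_4,\ell_5)$, with $\ell_0\cap\ell_1,\ \ell_2\cap\ell_3,\ \ell_4\cap\ell_5$ not collinear. Let $L_i(W_0,W_1,W_2)=0$ be an equation of $\ell_i$. Let $X_3\subset\mathbb{P}^5$ be given by $W_3^2=L_0L_1$, $W_4^2=L_2L_3$, $W_5^2=L_4L_5$, with $\mathbb{Z}_2^3$-covering map $[W_0:\cdots:W_5]\mapsto[W_0:W_1:W_2]$. The minimal resolution $X$ of $X_3$ is called a triple-double K3 surface. The Hirzebruch-Kummer covering $Y$ of exponent $2$ branched along $\ell_0,\ldots,\ell_5$ is constructed as follows: identify $\mathbb{P}^2$ with a linear plane $H\subset\mathbb{P}^5$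 (via $[L_0:\cdots:L_5]$), so that $\ell_i$ is the restriction to $H$ of the $i$-th coordinate hyperplane; if $H$ is defined by $\sum a_iW_i=\sum b_iW_i=\sum c_iW_i=0$, then $Y\subset\mathbb{P}^5$ is the K3 surface $\sum a_iW_i^2=\sum b_iW_i^2=\sum c_iW_i^2=0$, with $\mathbb{Z}_2^5$-covering map $Y\to H\cong\mathbb{P}^2$, $[W_0:\cdots:W_5]\mapsto[W_0^2:\cdots:W_5^2]$. For $i\neq j$, $\iota_{ij}$ is the restriction to $Y$ of the involution of $\mathbb{P}^5$ changing the sign of exactly the two coordinates $W_i$ and $W_j$; these are symplectic (they act trivially on $H^0(Y,\omega_Y)$). *)

(* Defs.v *)
(* Classical (point-based) algebraic geometry over an algebraically closed
   field, on top of Mathematical Components. *)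
From HB Require Import structures.
From mathcomp Require Import all_boot all_order all_algebra.
From mathcomp Require Import boolp classical_sets reals.
From mathcomp Require Import complex mpoly.
Set Implicit Arguments.
Unset Strict Implicit.
Unset Printing Implicit Defensive.
Import GRing.Theory.
Local Open Scope classical_set_scope.
Local Open Scope ring_scope.

(* A space with functions: a topology, and for every open [U] the functions
   regular on [U].  Functions are total, only their values on [U] matter.
   No axiom is recorded because only two constructions are used below:
   subsets of projective space and their quotients by finite groups. *)
Record space (K : Type) := Space {
  pt :> Type;
  opens : set (set pt);
  regular : set pt -> set (pt -> K)
}.

Section Spaces.
Variable K : Type.
Implicit Types X Y Z : space K.

Definition dense_open X (U : set X) : Prop :=
  opens U /\ forall W : set X, opens W -> W !=set0 -> (W `&` U) !=set0.

(* [f] restricts to a morphism from the open subspace [U] to [Y]. *)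
Definition morphism_on X Y (U : set X) (f : X -> Y) : Prop :=
  forall W : set Y, opens W ->
    opens (U `&` f @^-1` W) /\
    forall s : Y -> K, regular W s -> regular (U `&` f @^-1` W) (s \o f).

Definition morphism X Y (f : X -> Y) : Prop := morphism_on setT f.

Definition isomorphic X Y : Prop :=
  exists (f : X -> Y) (g : Y -> X),
    [/\ morphism f, morphism g, cancel f g & cancel g f].

(* A morphism which is an isomorphism over a dense open subset [U], with
   inverse [g] there, and whose preimage of [U] is dense. *)
Definition birational_morphism X Y (f : X -> Y) : Prop :=
  morphism f /\
  exists (U : set Y) (g : Y -> X),
    [/\ dense_open U, dense_open (f @^-1` U), morphism_on U g,
        forall y, U y -> f (g y) = y
      & forall x, U (f x) -> g (f x) = x].

Definition orbit_of X (G : set (X -> X)) (x : X) : set X :=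
  [set g x | g in G].

Definition orbits X (G : set (X -> X)) : Type :=
  set_type (range (orbit_of G)).

Definition orbit_proj X (G : set (X -> X)) (x : X) : orbits G :=
  SigSub (mem_set (imageP (orbit_of G) (I : [set: X] x))).

(* The quotient of [X] by a finite group [G] of automorphisms: the orbit
   space, with the quotient topology and the G-invariant regular functions. *)
Definition quotient_space X (G : set (X -> X)) : space K :=
  @Space K (orbits G)
    [set U | opens (@orbit_proj X G @^-1` U)]
    (fun U => [set s : orbits G -> K | regular (@orbit_proj X G @^-1` U)
                               (s \o @orbit_proj X G)]).

End Spaces.

Section Projective.
Variable K : closedFieldType.

(* P^n is the set of lines through 0 in K^(n+1). *)
Definition PP (n : nat) : Type := {l : {vspace 'rV[K]_n.+1} | \dim l == 1%N}.

Definition homogeneous n (p : {mpoly K[n]}) : Prop :=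
  exists d : nat, p \is d.-homog.

Definition vanishes_at n (p : {mpoly K[n.+1]}) (x : PP n) : Prop :=
  forall v, v \in val x -> p.@[v ord0] = 0.

Definition zero_locus n (E : set {mpoly K[n.+1]}) : set (PP n) :=
  [set x | forall p, E p -> vanishes_at p x].

Definition Zariski_closed n (A : set (PP n)) : Prop :=
  exists2 E : set {mpoly K[n.+1]},
    (forall p, E p -> homogeneous p) & A = zero_locus E.

(* A subset of P^n with its Zariski topology; a function is regular if
   locally it is a quotient of two homogeneous forms of the same degree. *)
Definition proj_space n (V : set (PP n)) : space K :=
  @Space K (set_type V)
    [set U | exists2 A : set (PP n), Zariski_closed A
               & forall x : set_type V, U x <-> ~ A (val x)]
    (fun U => [set s : set_type V -> K |
       forall x : set_type V, U x ->
       exists (A : set (PP n)) (d : nat) (p q : {mpoly K[n.+1]}),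
         [/\ Zariski_closed A, ~ A (val x), p \is d.-homog, q \is d.-homog
           & forall y : set_type V, U y -> ~ A (val y) ->
             forall v, v \in val (val y) -> v != 0 ->
               q.@[v ord0] != 0 /\ s y = p.@[v ord0] / q.@[v ord0]]]).

Definition irreducible n (V : set (PP n)) : Prop :=
  V !=set0 /\
  forall A B : set (PP n), Zariski_closed A -> Zariski_closed B ->
    V `<=` A `|` B -> V `<=` A \/ V `<=` B.

Definition projective_variety n (V : set (PP n)) : Prop :=
  Zariski_closed V /\ irreducible V.

Definition has_chain n (V : set (PP n)) (d : nat) : Prop :=
  exists Z : nat -> set (PP n),
    (forall i, (i <= d)%N -> projective_variety (Z i) /\ Z i `<=` V) /\
    (forall i, (i < d)%N -> Z i `<` Z i.+1).

Definition has_dim n (V : set (PP n)) (d : nat) : Prop :=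
  has_chain V d /\ ~ has_chain V d.+1.

(* Jacobian criterion, on the affine cone over [V]: at each nonzero vector
   above a point, the tangent space of the cone (cut out by the differentials
   of all homogeneous equations of [V]) has dimension [dim V + 1]. *)
Definition smooth n (V : set (PP n)) : Prop :=
  exists2 d, has_dim V d &
  forall (x : PP n) (v : 'rV[K]_n.+1), V x -> v \in val x -> v != 0 ->
  exists T : {vspace 'rV[K]_n.+1},
    \dim T = d.+1 /\
    forall t, t \in T <->
      (forall p : {mpoly K[n.+1]}, homogeneous p ->
         (forall y, V y -> vanishes_at p y) ->
         \sum_(i < n.+1) (p^`M(i)).@[v ord0] * t ord0 i = 0).

(* A resolution of singularities of a projective surface: the source is a
   smooth projective variety, hence the morphism is automatically proper.
   Conversely, smooth complete surfaces are projective, so there is no loss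
   in asking for a projective source. *)
Definition resolution (Z : space K) n (V : set (PP n))
    (f : proj_space V -> Z) : Prop :=
  [/\ projective_variety V, smooth V & birational_morphism f].

(* The minimal resolution of a surface: the one through which every
   resolution factors uniquely. *)
Definition minimal_resolution (Z : space K) n (V : set (PP n))
    (f : proj_space V -> Z) : Prop :=
  resolution f /\
  forall m (V' : set (PP m)) (f' : proj_space V' -> Z), resolution f' ->
    exists! g : proj_space V' -> proj_space V,
      morphism g /\ forall x, f (g x) = f' x.

(* Diagonal linear map changing the sign of the coordinates i and j. *)
Definition sign_change n (i j : 'I_n) : 'M[K]_n :=
  diag_mx (\row_k (if (k == i) || (k == j) then -1 else 1)).

Lemma sign_changeK n (i j : 'I_n) : sign_change i j *m sign_change i j = 1%:M.
Proof.
rewrite mulmx_diag -diag_const_mx; congr diag_mx; apply/rowP => k.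
by rewrite !mxE; case: ifP => _; rewrite ?mulrNN mulr1.
Qed.

Definition sign_change_lin n (i j : 'I_n.+1) : 'End('rV[K]_n.+1) :=
  linfun (mulmxr (sign_change i j)).

Lemma sign_change_linE n (i j : 'I_n.+1) v :
  sign_change_lin i j v = v *m sign_change i j.
Proof. by rewrite lfunE. Qed.

Lemma sign_change_linK n (i j : 'I_n.+1) :
  involutive (sign_change_lin i j).
Proof.
by move=> v; rewrite !sign_change_linE -mulmxA sign_changeK mulmx1.
Qed.

Lemma sign_change_dim n (i j : 'I_n.+1) (x : PP n) :
  \dim (sign_change_lin i j @: val x)%VS == 1%N.
Proof.
rewrite limg_dim_eq; first exact: (valP x).
suff /eqP -> : lker (sign_change_lin i j) == 0%VS by rewrite capv0.
by apply/lker0P; exact: inv_inj (@sign_change_linK n i j).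
Qed.

Definition PP_iota n (i j : 'I_n.+1) (x : PP n) : PP n :=
  exist _ (sign_change_lin i j @: val x)%VS (sign_change_dim i j x).

End Projective.

Notation "''o' k" := (@Ordinal 6 k isT) (at level 8, k at level 2).

Section TripleDouble.
Variable K : closedFieldType.

(* Six linear forms on K^3 are the columns of a 3 x 6 matrix [L]: the value
   of L_i at the row vector [u] is [(u *m L) ord0 i]. *)
Implicit Types (L : 'M[K]_(3, 6)) (a b c : 'rV[K]_6).

Definition line L (i : 'I_6) : set (PP K 2) :=
  [set x : PP K 2 | forall u : 'rV[K]_3, u \in val x -> (u *m L) ord0 i = 0].

(* The lines are automatically distinct: two equal lines and a third one
   would have a common point. *)
Definition no_triple_points L : Prop :=
  forall i j k : 'I_6, i != j -> i != k -> j != k ->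
    line L i `&` line L j `&` line L k = set0.

Definition collinear (A : set (PP K 2)) : Prop :=
  exists2 m : 'cV[K]_3, m != 0 &
    forall (x : PP K 2) (u : 'rV[K]_3), A x -> u \in val x -> u *m m = 0.

Definition triple_double_config L : Prop :=
  [/\ forall i, col i L != 0,
      no_triple_points L
    & ~ collinear ((line L 'o0 `&` line L 'o1) `|`
                   (line L 'o2 `&` line L 'o3) `|`
                   (line L 'o4 `&` line L 'o5))].

(* In the coordinates W_0, ..., W_5 the first three are those of P^2. *)
Definition X3_set L : set (PP K 5) :=
  [set x : PP K 5 | forall w : 'rV[K]_(3 + 3), w \in val x ->
     let l i := (lsubmx w *m L) ord0 i in
     [/\ w ord0 'o3 ^+ 2 = l 'o0 * l 'o1,
         w ord0 'o4 ^+ 2 = l 'o2 * l 'o3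
       & w ord0 'o5 ^+ 2 = l 'o4 * l 'o5]].

Definition X3 L : space K := proj_space (X3_set L).

(* H, given by the equations a, b, c, is the image of P^2 under L. *)
Definition plane_equations L a b c : Prop :=
  forall w : 'rV[K]_6, (exists u : 'rV[K]_3, w = u *m L) <->
    [/\ \sum_i a ord0 i * w ord0 i = 0, \sum_i b ord0 i * w ord0 i = 0
      & \sum_i c ord0 i * w ord0 i = 0].

Definition Y_set a b c : set (PP K 5) :=
  [set x : PP K 5 | forall w : 'rV[K]_6, w \in val x ->
     [/\ \sum_i a ord0 i * w ord0 i ^+ 2 = 0,
         \sum_i b ord0 i * w ord0 i ^+ 2 = 0
       & \sum_i c ord0 i * w ord0 i ^+ 2 = 0]].

Definition Y a b c : space K := proj_space (Y_set a b c).

Lemma PP_iota_Y a b c (i j : 'I_6) x :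
  Y_set a b c x -> Y_set a b c (PP_iota i j x).
Proof.
move=> Yx w /memv_imgP[v vx ->]; rewrite sign_change_linE.
have E k : ((v *m sign_change K i j) ord0 k) ^+ 2 = (v ord0 k) ^+ 2.
  rewrite mul_mx_diag !mxE; case: ifP => _; last by rewrite mulr1.
  by rewrite mulrN1 sqrrN.
by have [? ? ?] := Yx v vx; split;
  under eq_bigr => k _ do rewrite E.
Qed.

Definition iota a b c (i j : 'I_6) (y : Y a b c) : Y a b c :=
  SigSub (mem_set (@PP_iota_Y a b c i j _ (set_valP y))).

Definition iota_group a b c : set (Y a b c -> Y a b c) :=
  [set id; @iota a b c 'o0 'o1; @iota a b c 'o2 'o3; @iota a b c 'o4 'o5].

Definition Y_quotient a b c : space K := quotient_space (@iota_group a b c).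

(* [iota_group] is closed under composition: the linear maps multiply to -1
   times the third one, which acts trivially on P^5. *)
Lemma iotaK a b c i j : involutive (@iota a b c i j).
Proof.
move=> y; apply: val_inj; apply: val_inj => /=.
rewrite -limg_comp -[RHS]lim1g; congr (_ @: _)%VS.
by apply/lfunP => v; rewrite comp_lfunE id_lfunE sign_change_linK.
Qed.

Lemma iota_comp a b c (y : Y a b c) :
  iota 'o0 'o1 (iota 'o2 'o3 y) = iota 'o4 'o5 y.
Proof.
apply: val_inj; apply: val_inj => /=.
have E v : sign_change_lin K 'o0 'o1 (sign_change_lin K 'o2 'o3 v) =
           - sign_change_lin K 'o4 'o5 v.
  rewrite !sign_change_linE; apply/rowP => k; rewrite !mul_mx_diag !mxE.
  by case: k => [[|[|[|[|[|[|k]]]]]] ?] //=;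
    rewrite !(mulr1, mulrN1, opprK).
apply/vspaceP => w; rewrite -limg_comp; apply/memv_imgP/memv_imgP.
- move=> [v vy ->]; exists (- v); first by rewrite memvN.
  by rewrite comp_lfunE E linearN.
- move=> [v vy ->]; exists (- v); first by rewrite memvN.
  by rewrite comp_lfunE E linearN opprK.
Qed.

End TripleDouble.

(* Main.v *)
(* On affine cones the map Y -> X_3 is Psi : y |-> (u, y_0 y_1, y_2 y_3, y_4 y_5),
   where u is the point of P^2 with L_i(u) = y_i^2.  Its fibres are the orbits
   of the group {id, iota_01, iota_23, iota_45}.  A fraction p / q of forms
   which is invariant on an invariant set D is also p_chi / q_chi for every
   character chi of the group of sign changes of the three pairs of coordinates,
   hence p_chi q_chi / q_chi^2; the numerator and the denominator are now
   invariant, and an invariant form is a form in y_i^2 and y_0 y_1, y_2 y_3,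
   y_4 y_5, so it comes from X_3.  This shows that open sets and regular
   functions descend, whence Y / Z_2^2 is isomorphic to X_3, and minimal
   resolutions of isomorphic spaces are isomorphic by the universal property. *)
Require Import Defs.
From mathcomp Require Import all_boot all_order all_algebra.
From mathcomp Require Import boolp classical_sets reals.
From mathcomp Require Import complex mpoly zify.
Set Implicit Arguments.
Unset Strict Implicit.
Unset Printing Implicit Defensive.
Import GRing.Theory Num.Theory.
Local Open Scope classical_set_scope.
Local Open Scope ring_scope.

(** * Morphisms, birational morphisms and quotients of spaces with functions *)

Section SpaceTheory.
Variable K : Type.
Implicit Types X Y Z : Defs.space K.

Lemma morphism_id X : morphism (@id X).
Proof. by move=> W oW; rewrite setTI. Qed.

Lemma morphism_on_comp X Y Z (U : set X) (f : X -> Y) (g : Y -> Z) :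
  morphism_on U f -> morphism g -> morphism_on U (g \o f).
Proof.
move=> mf mg W oW; have [] := mg W oW; rewrite setTI => ogW rg.
by have [oU rf] := mf _ ogW; split=> // s rs; apply/(rf (s \o g))/rg.
Qed.

Lemma morphism_comp X Y Z (f : X -> Y) (g : Y -> Z) :
  morphism f -> morphism g -> morphism (g \o f).
Proof. exact: morphism_on_comp. Qed.

Lemma morphism_on_precomp X Y Z (U : set Y) (f : X -> Y) (g : Y -> Z) :
  morphism f -> morphism_on U g -> morphism_on (f @^-1` U) (g \o f).
Proof.
move=> mf mg W oW; have [oU rg] := mg W oW.
have [] := mf _ oU; rewrite setTI => ofU rf.
by split=> // s rs; apply/(rf (s \o g))/rg.
Qed.

Lemma isomorphic_refl X : isomorphic X X.
Proof. by exists id, id; split=> //; exact: morphism_id. Qed.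

Lemma morphism_preimage_open X Y (f : X -> Y) (W : set Y) :
  morphism f -> opens W -> opens (f @^-1` W).
Proof. by move=> mf /mf[]; rewrite setTI. Qed.

Lemma dense_open_iso X Y (f : X -> Y) (g : Y -> X) (U : set X) :
  morphism f -> morphism g -> cancel f g -> cancel g f ->
  dense_open U -> dense_open (g @^-1` U).
Proof.
move=> mf mg fK gK [oU dU]; split; first exact: morphism_preimage_open.
move=> W oW [y Wy]; have [|x [Wx Ux]] := dU _ (morphism_preimage_open mf oW).
  by exists (g y); rewrite /= gK.
by exists (f x); split=> //=; rewrite fK.
Qed.

Lemma birational_morphism_iso X Y Z (f : X -> Y) (phi : Y -> Z) (psi : Z -> Y) :
  morphism phi -> morphism psi -> cancel phi psi -> cancel psi phi ->
  birational_morphism f -> birational_morphism (phi \o f).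
Proof.
move=> mphi mpsi phiK psiK [mf [U [g [dU dfU mg gr gl]]]].
split; first exact: morphism_comp.
exists (psi @^-1` U), (g \o psi); split.
- exact: dense_open_iso phiK psiK _.
- suff -> : (phi \o f) @^-1` (psi @^-1` U) = f @^-1` U by [].
  by rewrite predeqE => x /=; rewrite phiK.
- exact: morphism_on_precomp.
- by move=> z /= Uz; rewrite gr.
- by move=> x /=; rewrite phiK => Ux; rewrite gl.
Qed.

(* Universal property of the quotient: [P] identifies the orbit space with
   [X'] as soon as openness and regularity can be tested after pulling back. *)
Lemma quotient_isomorphic X X' (G : set (X -> X)) (P : X -> X') :
  morphism P ->
  (forall x, exists y, P y = x) ->
  (forall y, orbit_of G y = [set z | P z = P y]) ->
  (forall U : set X', opens (P @^-1` U) -> opens U) ->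
  (forall (U : set X') s, regular (P @^-1` U) (s \o P) -> regular U s) ->
  isomorphic (quotient_space G) X'.
Proof.
move=> mP Psurj orbP Popen Preg.
have projP y z : (orbit_proj G y = orbit_proj G z) <-> (P y = P z).
  split=> [/(congr1 val)/=|Pyz]; last by apply: val_inj; rewrite /= !orbP Pyz.
  by rewrite !orbP => /predeqP/(_ y)/= [/(_ erefl)].
(* [r] and, below, [t] are arbitrary set-theoretic sections of [orbit_proj] and [P]; by [projP] the
   maps built from them do not depend on the choices. *)
have /boolp.choice[r rP] (o : orbits G) : exists y, orbit_proj G y = o.
  have [y _ oy] := set_valP o.
  by exists y; apply: val_inj.
have [t tP] := boolp.choice Psurj.
exists (P \o r), (@orbit_proj _ X G \o t).
have fE y : P (r (orbit_proj G y)) = P y by apply/projP; rewrite rP.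
have gE y : orbit_proj G (t (P y)) = orbit_proj G y by apply/projP; rewrite tP.
split.
- move=> W oW; have [] := mP W oW; rewrite !setTI => oPW rPW.
  have E : @orbit_proj _ X G @^-1` ((P \o r) @^-1` W) = P @^-1` W.
    by rewrite predeqE => y /=; rewrite fE.
  split; first by rewrite /= E.
  move=> s /rPW; rewrite /= E.
  suff -> : (s \o (P \o r)) \o @orbit_proj _ X G = s \o P by [].
  by apply: funext => y /=; rewrite fE.
- move=> W oW; rewrite setTI.
  have E : P @^-1` ((@orbit_proj _ X G \o t) @^-1` W) = @orbit_proj _ X G @^-1` W.
    by rewrite predeqE => y /=; rewrite gE.
  split; first by apply: Popen; rewrite E.
  move=> s rs; apply: Preg; rewrite E.
  suff -> : (s \o (@orbit_proj _ X G \o t)) \o P = s \o @orbit_proj _ X G by [].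
  by apply: funext => y /=; rewrite gE.
- by move=> o /=; rewrite -[in RHS](rP o) -{1}(rP o) gE rP.
- by move=> x /=; rewrite fE.
Qed.

End SpaceTheory.

(** * Minimal resolutions under isomorphism, and their uniqueness *)

Section MinimalResolution.
Variable K : closedFieldType.

Lemma resolution_iso (Z Z' : Defs.space K) n (V : set (PP K n))
    (f : proj_space V -> Z) (phi : Z -> Z') (psi : Z' -> Z) :
  morphism phi -> morphism psi -> cancel phi psi -> cancel psi phi ->
  resolution f -> resolution (phi \o f).
Proof.
move=> mphi mpsi phiK psiK [pV sV bf]; split=> //.
exact: birational_morphism_iso phiK psiK _.
Qed.

Lemma minimal_resolution_iso (Z Z' : Defs.space K) n (V : set (PP K n))
    (f : proj_space V -> Z) (phi : Z -> Z') (psi : Z' -> Z) :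
  morphism phi -> morphism psi -> cancel phi psi -> cancel psi phi ->
  minimal_resolution f -> minimal_resolution (phi \o f).
Proof.
move=> mphi mpsi phiK psiK [rf minf]; split.
  exact: resolution_iso phiK psiK _.
move=> m V' f' rf'.
have [g [[mg fg] ug]] := minf _ _ _ (resolution_iso mpsi mphi psiK phiK rf').
exists g; split=> [|h [mh fh]].
  by split=> // x; rewrite /= fg /= psiK.
by apply: ug; split=> // x; rewrite /= -fh /= phiK.
Qed.

Lemma minimal_resolution_unique (Z : Defs.space K) n m
    (V : set (PP K n)) (V' : set (PP K m))
    (f : proj_space V -> Z) (f' : proj_space V' -> Z) :
  minimal_resolution f -> minimal_resolution f' ->
  isomorphic (proj_space V) (proj_space V').
Proof.
move=> [rf minf] [rf' minf'].
have [g [[mg gf] _]] := minf' _ _ _ rf.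
have [h [[mh hf] _]] := minf _ _ _ rf'.
(* Both [u] and [id] factor [e] through itself, so the uniqueness clause of minimality identifies
   them. *)
have endo_id k (W : set (PP K k)) (e : proj_space W -> Z) u :
    minimal_resolution e -> morphism u -> (forall x, e (u x) = e x) -> u = id.
  move=> [re mine] mu eu; have [v [_ uv]] := mine _ _ _ re.
  rewrite -(uv u) ?(uv id) //; split=> //; exact: morphism_id.
exists g, h; split=> //.
- have /(congr1 (fun u => u _)) E := @endo_id _ _ f (h \o g) (conj rf minf)
    (morphism_comp mg mh) (fun x => etrans (hf (g x)) (gf x)).
  by move=> x; have := E x.
- have /(congr1 (fun u => u _)) E := @endo_id _ _ f' (g \o h) (conj rf' minf')
    (morphism_comp mh mg) (fun x => etrans (gf (h x)) (hf x)).
  by move=> x; have := E x.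
Qed.

End MinimalResolution.

(** * Points of projective space and their spanning vectors *)

Section ProjectivePoints.
Variable K : closedFieldType.
Variable n : nat.
Implicit Types (x : PP K n) (v w : 'rV[K]_n.+1).

Lemma PP_vec x : exists2 v, v \in val x & v != 0.
Proof.
exists (vpick (val x)); first exact: memv_pick.
by rewrite vpick0 -dimv_eq0 (eqP (valP x)).
Qed.

Lemma PP_line x v : v \in val x -> v != 0 -> val x = <[v]>%VS.
Proof.
move=> vx v0; apply/eqP; rewrite eq_sym eqEdim -memvE vx /=.
by rewrite dim_vline v0 (eqP (valP x)).
Qed.

Lemma PP_scale x v w :
  v \in val x -> v != 0 -> w \in val x -> exists k, w = k *: v.
Proof. by move=> vx v0; rewrite (PP_line vx v0) => /vlineP. Qed.

Lemma PP_eq x x' v : v \in val x -> v \in val x' -> v != 0 -> x = x'.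
Proof.
by move=> vx vx' v0; apply: val_inj; rewrite (PP_line vx v0) (PP_line vx' v0).
Qed.

Lemma PP_of_vec v : v != 0 -> {x : PP K n | v \in val x}.
Proof.
move=> v0; have d : \dim <[v]> == 1%N by rewrite dim_vline v0.
by exists (exist _ <[v]>%VS d); exact: memv_line.
Qed.

Lemma meval_homogZ d (p : {mpoly K[n.+1]}) k v : p \is d.-homog ->
  p.@[(k *: v) ord0] = k ^+ d * p.@[v ord0].
Proof.
move=> /dhomogP hp; rewrite !mevalE mulr_sumr; apply: eq_big_seq => m /hp <-.
rewrite mulrCA; congr (_ * _); rewrite /= mdegE -prodrXr -big_split /=.
by apply: eq_bigr => i _; rewrite mxE exprMn.
Qed.

Lemma vanishes_at_vec d (p : {mpoly K[n.+1]}) x v : p \is d.-homog ->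
  v \in val x -> v != 0 -> p.@[v ord0] = 0 -> vanishes_at p x.
Proof.
move=> hp vx v0 pv w /(PP_scale vx v0)[k ->].
by rewrite (meval_homogZ _ _ hp) pv mulr0.
Qed.

Lemma meval_neq0 d (p : {mpoly K[n.+1]}) x v : p \is d.-homog ->
  v \in val x -> v != 0 -> ~ vanishes_at p x -> p.@[v ord0] != 0.
Proof. by move=> hp vx v0 np; apply/eqP => /(vanishes_at_vec hp vx v0). Qed.

End ProjectivePoints.

(* The part of [p] on which changing the sign of the variables [i] and [j]
   acts by [(-1) ^+ b]. *)
Definition parity_part (R : nzRingType) n (i j : 'I_n) (b : bool)
    (p : {mpoly R[n]}) : {mpoly R[n]} :=
  \sum_(m <- msupp p | odd (m i + m j) == b) p@_m *: 'X_[m].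

Section ParityPart.
Variables (R : comNzRingType) (n : nat) (i j : 'I_n).
Implicit Types (p : {mpoly R[n]}) (v : 'I_n -> R).

Lemma msupp_parity_part b p m : m \in msupp (parity_part i j b p) ->
  m \in msupp p /\ odd (m i + m j) = b.
Proof.
move=> /msupp_sum_le/flattenP[s /mapP[m']].
rewrite mem_filter => /andP[/eqP mb m'p] -> /msuppZ_le.
by rewrite msuppX inE => /eqP ->.
Qed.

Lemma parity_part_homog d b p :
  p \is d.-homog -> parity_part i j b p \is d.-homog.
Proof. by move=> /dhomogP hp; apply/dhomogP => m /msupp_parity_part[/hp]. Qed.

(** Passing to [v'] multiplies the monomial [m] by [(-1) ^+ (m i + m j)], so the right-hand side
    doubles the monomials of the chosen parity and cancels the others. Doubling on the left avoids a
    division by two. *)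
Lemma parity_part_meval b p v v' : i != j ->
  (forall k, v' k = (if (k == i) || (k == j) then -1 else 1) * v k) ->
  (parity_part i j b p).@[v] *+ 2 = p.@[v] + (-1) ^+ b * p.@[v'].
Proof.
move=> ij v'E; rewrite /parity_part raddf_sum /= -sumrMnl.
rewrite [p.@[v]]mevalE [p.@[v']]mevalE mulr_sumr -big_split /=.
rewrite big_mkcond /=; apply: eq_bigr => m _.
have -> : \prod_k v' k ^+ m k = (-1) ^+ odd (m i + m j) * \prod_k v k ^+ m k.
  under eq_bigr do rewrite v'E exprMn.
  rewrite big_split /=; congr (_ * _).
  rewrite (bigD1 i) //= (bigD1 j) 1?eq_sym //= eqxx orTb eqxx orbT mulrA.
  rewrite -exprD signr_odd big1 ?mulr1 // => k /andP[/negPf -> /negPf ->] /=.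
  exact: expr1n.
rewrite mevalZ mevalX [p@_m * (_ ^+ _ * _)]mulrCA; set c := p@_m * _.
case: eqP => [->|].
  by rewrite signrMK mulr2n.
by case: b (odd _) => [] [] // _; rewrite expr0 expr1 !mulN1r mul1r subrr.
Qed.

End ParityPart.

(** * Six coordinates as three pairs, or as two blocks of three *)

Lemma ord3P (P : 'I_3 -> Prop) : P 0 -> P 1 -> P 2%:R -> forall j, P j.
Proof.
move=> P0 P1 P2 [[|[|[|]]]] //= ?.
- by rewrite (_ : Ordinal _ = 0) //; apply: val_inj.
- by rewrite (_ : Ordinal _ = 1) //; apply: val_inj.
- by rewrite (_ : Ordinal _ = 2%:R) //; apply: val_inj.
Qed.

(** [evn j] and [odn j] index the two lines of the [j]-th pair, [lft j] the coordinates of the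
    plane, [rgt j] the square roots adjoined in X_3. *)
Definition evn (j : 'I_3) : 'I_6 := inord j.*2.
Definition odn (j : 'I_3) : 'I_6 := inord j.*2.+1.
Definition lft (j : 'I_3) : 'I_6 := lshift 3 j.
Definition rgt (j : 'I_3) : 'I_6 := rshift 3 j.

Lemma evnE j : evn j = j.*2 :> nat.
Proof. by rewrite inordK //; case: j => [[|[|[|]]]]. Qed.

Lemma odnE j : odn j = j.*2.+1 :> nat.
Proof. by rewrite inordK //; case: j => [[|[|[|]]]]. Qed.

Lemma ord6_ind (P : 'I_6 -> Prop) :
  (forall j, P (evn j)) -> (forall j, P (odn j)) -> forall i, P i.
Proof.
move=> Pe Po i; have lt3 : (i./2 < 3)%N by rewrite ltn_half_double.
have iE := odd_double_half i; have [io|ie] := boolP (odd i).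
  suff -> : i = odn (Ordinal lt3) by [].
  by apply: val_inj; rewrite /= odnE /= -[LHS]iE io.
suff -> : i = evn (Ordinal lt3) by [].
by apply: val_inj; rewrite /= evnE /= -[LHS]iE (negPf ie).
Qed.

Lemma evn_neq_odn j : evn j != odn j.
Proof. by rewrite -val_eqE /= evnE odnE neq_ltn ltnSn. Qed.

Lemma evn_odnF j k : (evn j == odn k) = false.
Proof.
apply/negP => /eqP/(congr1 (odd \o val)) /=.
by rewrite evnE odnE /= !odd_double.
Qed.

Lemma evn_eq j k : (evn j == evn k) = (j == k).
Proof. by rewrite -!val_eqE /= !evnE (inj_eq double_inj). Qed.

Lemma odn_eq j k : (odn j == odn k) = (j == k).
Proof. by rewrite -!val_eqE /= !odnE eqSS (inj_eq double_inj). Qed.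

Lemma ord6_lr (P : 'I_6 -> Prop) :
  (forall j, P (lft j)) -> (forall j, P (rgt j)) -> forall i, P i.
Proof.
by move=> Pl Pr i; rewrite -(@splitK 3 3 i); case: split => j /=.
Qed.

Lemma prod_ord6 (R : comNzRingType) (F : 'I_6 -> R) :
  \prod_i F i = \prod_(j < 3) (F (evn j) * F (odn j)).
Proof.
rewrite 6!big_ord_recl big_ord0 mulr1 3!big_ord_recl big_ord0 mulr1 -!mulrA.
by congr (F _ * (F _ * (F _ * (F _ * (F _ * F _)))));
  apply: val_inj; rewrite /= ?evnE ?odnE.
Qed.

Lemma sum_ord6 (F : 'I_6 -> nat) :
  (\sum_i F i = \sum_(j < 3) (F (evn j) + F (odn j)))%N.
Proof.
rewrite 6!big_ord_recl big_ord0 addn0 3!big_ord_recl big_ord0 addn0 -!addnA.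
by congr (F _ + (F _ + (F _ + (F _ + (F _ + F _)))))%N;
  apply: val_inj; rewrite /= ?evnE ?odnE.
Qed.

(** * Descent of invariant forms along the map of cones *)

Section Descent.
Variable K : numClosedFieldType.
Variables (L : 'M[K]_(3, 6)) (M : 'M[K]_(6, 3)).
Hypothesis LM : L *m M = 1%:M.
Implicit Types v w : 'rV[K]_6.

Definition base w : 'rV[K]_3 := \row_j w ord0 (lft j).

Definition squares v : 'rV[K]_6 := \row_i v ord0 i ^+ 2.

(** The affine cone over Y, via the parametrisation [L] of the plane. *)
Definition Ycone v : Prop := exists u : 'rV[K]_3, squares v = u *m L.

(* Equations of the map [Y -> X3] lifted to cones; [M] recovers the
   coordinates on the plane from the values of the six linear forms. *)
Definition quadric (i : 'I_6) : {mpoly K[6]} :=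
  match @split 3 3 i with
  | inl j => \sum_k M k j *: 'X_k ^+ 2
  | inr j => 'X_(evn j) * 'X_(odn j)
  end.

Definition Psi v : 'rV[K]_6 := \row_i (quadric i).@[v ord0].

Lemma Psi_lft v j : Psi v ord0 (lft j) = (squares v *m M) ord0 j.
Proof.
rewrite !mxE /quadric (unsplitK (inl j : 'I_3 + 'I_3)) raddf_sum /=.
by apply: eq_bigr => k _; rewrite mevalZ rmorphXn /= mevalXU mxE mulrC.
Qed.

Lemma Psi_rgt v j : Psi v ord0 (rgt j) = v ord0 (evn j) * v ord0 (odn j).
Proof.
by rewrite !mxE /quadric (unsplitK (inr j : 'I_3 + 'I_3)) mevalM !mevalXU.
Qed.

Lemma base_Psi v : base (Psi v) = squares v *m M.
Proof. by apply/rowP => j; rewrite mxE Psi_lft. Qed.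

Lemma base_PsiL v : Ycone v -> base (Psi v) *m L = squares v.
Proof. by move=> [u vE]; rewrite base_Psi vE -(mulmxA u) LM mulmx1. Qed.

Lemma quadric_homog i : quadric i \is 2.-homog.
Proof.
rewrite /quadric; case: split => j.
  apply: rpred_sum => k _; apply/dhomogZ/(@dhomogMn _ _ _ 1).
  by rewrite dhomogX /= mdeg1.
by apply: (dhomogM (d := 1) (e := 1)); rewrite dhomogX /= mdeg1.
Qed.

Lemma PsiZ k v : Psi (k *: v) = k ^+ 2 *: Psi v.
Proof. by apply/rowP => i; rewrite !mxE (meval_homogZ _ _ (quadric_homog i)). Qed.

(** By [base_PsiL] the squares of the coordinates of [v] are linear in [Psi v]. Thus [Psi] has no
    base point on the cone and induces a map of projective points. *)
Lemma Psi_eq0 v : Ycone v -> Psi v = 0 -> v = 0.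
Proof.
move=> /base_PsiL vE Pv0; apply/rowP => i.
have /rowP/(_ i) : squares v = 0.
  by rewrite -vE Pv0 (_ : base 0 = 0) ?mul0mx //; apply/rowP => j; rewrite !mxE.
by rewrite !mxE => /eqP; rewrite expf_eq0 /= => /eqP.
Qed.

Definition pull (p : {mpoly K[6]}) : {mpoly K[6]} :=
  p \mPo [tuple quadric i | i < 6].

Lemma pull_meval p v : (pull p).@[v ord0] = p.@[Psi v ord0].
Proof.
by rewrite /pull comp_mpoly_meval; apply: meval_eq => i; rewrite tnth_mktuple mxE.
Qed.

Lemma homog_prod I (r : seq I) (F : I -> {mpoly K[6]}) (d : I -> nat) :
  (forall i, F i \is (d i).-homog) ->
  \prod_(i <- r) F i \is (\sum_(i <- r) d i).-homog.
Proof.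
move=> hF; elim: r => [|i r IH]; first by rewrite !big_nil dhomog1.
by rewrite !big_cons; exact: dhomogM.
Qed.

Lemma pull_homog d p : p \is d.-homog -> pull p \is (d * 2).-homog.
Proof.
move=> /dhomogP hp; rewrite /pull comp_mpolyEX big_seq.
apply: rpred_sum => m /hp /= <-; apply: dhomogZ.
rewrite comp_mpolyX mdegE big_distrl.
apply: homog_prod => i; rewrite tnth_mktuple /= mulnC.
exact/dhomogMn/quadric_homog.
Qed.

(** The equation of the [i]-th line as a form in the coordinates of X_3; by [base_PsiL] it pulls
    back to the square of the [i]-th coordinate on the cone. *)
Definition linform i : {mpoly K[6]} := \sum_k L k i *: 'X_(lft k).

Lemma linform_homog i : linform i \is 1.-homog.
Proof.
by apply: rpred_sum => k _; apply: dhomogZ; rewrite dhomogX /= mdeg1.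
Qed.

Lemma linform_meval i w : (linform i).@[w ord0] = (base w *m L) ord0 i.
Proof.
rewrite raddf_sum mxE; apply: eq_bigr => k _ /=.
by rewrite mevalZ mevalXU mxE mulrC.
Qed.

Definition flip j : 'rV[K]_6 -> 'rV[K]_6 := sign_change_lin K (evn j) (odn j).

Lemma flipE j v k : flip j v ord0 k =
  (if (k == evn j) || (k == odn j) then -1 else 1) * v ord0 k.
Proof. by rewrite /flip sign_change_linE mul_mx_diag !mxE mulrC. Qed.

Lemma flip_evn j v k : flip j v ord0 (evn k) = (-1) ^+ (k == j) * v ord0 (evn k).
Proof. by rewrite flipE evn_eq evn_odnF orbF; case: eqP. Qed.

Lemma flip_odn j v k : flip j v ord0 (odn k) = (-1) ^+ (k == j) * v ord0 (odn k).
Proof. by rewrite flipE odn_eq eq_sym evn_odnF; case: eqP. Qed.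

Lemma squares_flip j v : squares (flip j v) = squares v.
Proof.
apply/rowP => i; rewrite !mxE flipE exprMn.
by case: ifP; rewrite ?sqrrN expr1n mul1r.
Qed.

Lemma Psi_flip j v : Psi (flip j v) = Psi v.
Proof.
apply/rowP; apply: ord6_lr => k; first by rewrite !Psi_lft squares_flip.
by rewrite !Psi_rgt flip_evn flip_odn mulrACA -expr2 sqrr_sign mul1r.
Qed.

Definition descends d (f : {mpoly K[6]}) : Prop :=
  exists2 g : {mpoly K[6]}, g \is d.-homog &
    forall v, Ycone v -> f.@[v ord0] = g.@[Psi v ord0].

(** Within each pair the two exponents have the same parity. Even powers come from powers of the
    forms [linform]; when both exponents are odd, the remaining product of the pair is the
    coordinate [rgt j]. *)
Lemma descendsZX d (m : 'X_{1..6}) c : mdeg m = d.*2 ->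
  (forall j, odd (m (evn j) + m (odn j)) = false) -> descends d (c *: 'X_[m]).
Proof.
move=> md me; have mo j : odd (m (odn j)) = odd (m (evn j)).
  by have := me j; rewrite oddD; case: odd; case: odd.
pose g := \prod_(j < 3)
  (linform (evn j) ^+ (m (evn j))./2 * linform (odn j) ^+ (m (odn j))./2 *
   'X_(rgt j) ^+ odd (m (evn j))).
exists (c *: g).
  have -> : d = (\sum_(j < 3)
      (1 * (m (evn j))./2 + 1 * (m (odn j))./2 + 1 * odd (m (evn j))))%N.
    apply: double_inj; rewrite -md mdegE sum_ord6 -muln2 big_distrl /=.
    apply: eq_bigr => j _; rewrite !mul1n muln2 !doubleD.
    rewrite -[in LHS](odd_double_half (m (evn j))).
    by rewrite -[in LHS](odd_double_half (m (odn j))) mo -[in RHS]addnn; lia.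
  apply/dhomogZ/homog_prod => j.
  by apply: dhomogM; [apply: dhomogM|]; apply: dhomogMn;
    rewrite ?linform_homog // dhomogX /= mdeg1.
move=> v Yv; rewrite !mevalZ mevalX; congr (_ * _).
rewrite prod_ord6 rmorph_prod; apply: eq_bigr => j _ /=.
rewrite !mevalM !rmorphXn /= !linform_meval mevalXU base_PsiL // Psi_rgt !mxE.
rewrite -!exprM !mul2n -{1}(odd_double_half (m (evn j))).
rewrite -{1}(odd_double_half (m (odn j))) mo !exprD exprMn mulrACA mulrC.
by [].
Qed.

Lemma descendsD d f f' : descends d f -> descends d f' -> descends d (f + f').
Proof.
move=> [g hg gE] [g' hg' gE']; exists (g + g'); first exact: rpredD.
by move=> v Yv; rewrite !mevalD gE // gE'.
Qed.

Lemma descends0 d : descends d 0.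
Proof. by exists 0; [exact: rpred0|move=> v _; rewrite !meval0]. Qed.

(** A monomial of [p] times one of [q] has even degree in each pair, the two parities being equal.
    Its total degree is [2 d], which becomes [d] after descent. *)
Lemma descendsM d p q (b : 'I_3 -> bool) :
  p \is d.-homog -> q \is d.-homog ->
  (forall m j, m \in msupp p -> odd (m (evn j) + m (odn j)) = b j) ->
  (forall m j, m \in msupp q -> odd (m (evn j) + m (odn j)) = b j) ->
  descends d (p * q).
Proof.
move=> /dhomogP hp /dhomogP hq bp bq; rewrite [p]mpolyE [q]mpolyE big_distrlr /=.
rewrite big_seq; apply: big_ind => [||m mp]; [exact: descends0|exact: descendsD|].
rewrite big_seq; apply: big_ind => [||m' mq]; [exact: descends0|exact: descendsD|].
rewrite -scalerAl -scalerAr scalerA -mpolyXD; apply: descendsZX.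
  by rewrite mdegD (hp _ mp) (hq _ mq) addnn.
by move=> j; rewrite !mnmDE addnACA oddD (bp _ _ mp) (bq _ _ mq) addbb.
Qed.

Section Fraction.
Variables (D : set 'rV[K]_6) (s : 'rV[K]_6 -> K).
Hypothesis DY : forall v, D v -> Ycone v.
Hypothesis Dflip : forall j v, D v -> D (flip j v).
Hypothesis sflip : forall j v, D v -> s (flip j v) = s v.

(** As [D] and [s] are invariant, the relation may be flipped and added to or subtracted from
    itself, which proves it for each parity part. Since [q] is the sum of its two parts, one of them
    is nonzero at [v0]. *)
Lemma parity_part_fraction j p q v0 :
  (forall v, D v -> s v * q.@[v ord0] = p.@[v ord0]) -> q.@[v0 ord0] != 0 ->
  exists2 b, (parity_part (evn j) (odn j) b q).@[v0 ord0] != 0 &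
    forall v, D v -> s v * (parity_part (evn j) (odn j) b q).@[v ord0] =
                     (parity_part (evn j) (odn j) b p).@[v ord0].
Proof.
move=> spq q0; have K2 (x : K) : x *+ 2 = 0 -> x = 0.
  by move=> /eqP; rewrite mulrn_eq0 => /eqP.
have partE b (r : {mpoly K[6]}) v :=
  parity_part_meval b r (evn_neq_odn j) (flipE j v).
have sE b v : D v -> s v * (parity_part (evn j) (odn j) b q).@[v ord0] =
                     (parity_part (evn j) (odn j) b p).@[v ord0].
  move=> Dv; apply/eqP; rewrite -subr_eq0; apply/eqP/K2.
  rewrite mulrnBl -mulrnAr !partE mulrDr spq // mulrCA.
  by rewrite -(sflip j Dv) spq ?subrr //; exact: Dflip.
have [[b qb]|q00] :=
  pselect (exists b, (parity_part (evn j) (odn j) b q).@[v0 ord0] != 0).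
  by exists b => // v; exact: sE.
case/negP: q0; apply/eqP/K2.
have part0 b : (parity_part (evn j) (odn j) b q).@[v0 ord0] *+ 2 = 0.
  apply/eqP; rewrite mulrn_eq0 /=; apply/negPn/negP => qb.
  by apply: q00; exists b.
have := congr2 +%R (part0 true) (part0 false).
rewrite /= !partE expr1 expr0 mulN1r mul1r addr0 addrACA addNr addr0 -mulr2n.
by [].
Qed.

(* Of the eight components of [q] under the sign changes, one does not vanish
   at [v0]; multiplying numerator and denominator by it makes both invariant. *)
Lemma invariant_fraction d p q v0 : p \is d.-homog -> q \is d.-homog ->
  (forall v, D v -> s v * q.@[v ord0] = p.@[v ord0]) ->
  Ycone v0 -> q.@[v0 ord0] != 0 ->
  exists g h : {mpoly K[6]}, [/\ g \is d.-homog, h \is d.-homog,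
    h.@[Psi v0 ord0] != 0 &
    forall v, D v -> s v * h.@[Psi v ord0] = g.@[Psi v ord0]].
Proof.
move=> hp hq spq Yv0 q0.
pose part j b (f : {mpoly K[6]}) := parity_part (evn j) (odn j) b f.
have [b0 q1 spq1] := parity_part_fraction 0 spq q0.
have [b1 q2 spq2] := parity_part_fraction 1 spq1 q1.
have [b2 q3 spq3] := parity_part_fraction 2%:R spq2 q2.
pose comp f := part 2%:R b2 (part 1 b1 (part 0 b0 f)).
have homog_comp f : f \is d.-homog -> comp f \is d.-homog.
  by move=> hf; do 3!apply: parity_part_homog.
(* Taking a part only selects monomials, so the parities imposed first persist. *)
have parity_comp f m j : m \in msupp (comp f) ->
    odd (m (evn j) + m (odn j)) = nth false [:: b0; b1; b2] j.
  move=> /msupp_parity_part[/msupp_parity_part[/msupp_parity_part[_ e0] e1] e2].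
  by move: j; apply: ord3P.
have [g hg gE] := descendsM (homog_comp p hp) (homog_comp q hq)
  (parity_comp p) (parity_comp q).
have [h hh hE] := descendsM (homog_comp q hq) (homog_comp q hq)
  (parity_comp q) (parity_comp q).
exists g, h; split=> //; first by rewrite -hE // mevalM mulf_neq0.
by move=> v Dv; rewrite -hE -?gE ?mevalM ?mulrA ?spq3 //; exact: DY.
Qed.

End Fraction.
End Descent.

(** * The covering of X_3 by Y *)

Section QuotientIsX3.
Variable K : numClosedFieldType.
Variables (L : 'M[K]_(3, 6)) (M : 'M[K]_(6, 3)) (a b c : 'rV[K]_6).
Hypothesis LM : L *m M = 1%:M.
Hypothesis Labc : plane_equations L a b c.
Notation Ycone := (Ycone L).
Notation Psi := (Psi M).
Notation Yabc := (Y a b c).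
Implicit Types v w : 'rV[K]_6.

Lemma Y_setP (x : PP K 5) : Y_set a b c x <-> forall v, v \in val x -> Ycone v.
Proof.
have sqE (d v : 'rV[K]_6) : \sum_i d ord0 i * (squares v) ord0 i =
    \sum_i d ord0 i * v ord0 i ^+ 2 by apply: eq_bigr => i _; rewrite mxE.
split=> Yx v vx; first by apply/Labc; rewrite !sqE; exact: Yx.
by move: (Yx v vx) => /Labc; rewrite !sqE.
Qed.

Lemma Y_Ycone (y : Yabc) v : v \in val (val y) -> Ycone v.
Proof. by have /Y_setP Yy := set_valP y; exact: Yy. Qed.

Lemma rgt_evn_odnE : [/\ rgt 0 = 'o3, rgt 1 = 'o4 & rgt 2%:R = 'o5] /\
  [/\ evn 0 = 'o0, evn 1 = 'o2 & evn 2%:R = 'o4] /\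
  [/\ odn 0 = 'o1, odn 1 = 'o3 & odn 2%:R = 'o5].
Proof. by do !split; apply: val_inj; rewrite /= ?evnE ?odnE. Qed.

Lemma base_lsubmx w : @lsubmx K 1 3 3 w = base w.
Proof. by apply/rowP => j; rewrite !mxE. Qed.

Lemma X3_setP (x : PP K 5) : X3_set L x <->
  forall w, w \in val x -> forall j, w ord0 (rgt j) ^+ 2 =
    (base w *m L) ord0 (evn j) * (base w *m L) ord0 (odn j).
Proof.
have [[r0 r1 r2] [[e0 e1 e2] [o0 o1 o2]]] := rgt_evn_odnE.
split=> [Xx w wx|Xx w wx].
  have := Xx w wx; cbv zeta; rewrite base_lsubmx => -[l0 l1 l2].
  by apply: ord3P; rewrite ?(r0, r1, r2) ?(e0, e1, e2) ?(o0, o1, o2).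
have := (Xx w wx 0, Xx w wx 1, Xx w wx 2%:R); rewrite r0 r1 r2 e0 e1 e2 o0 o1 o2.
by cbv zeta; rewrite base_lsubmx => -[[l0 l1] l2].
Qed.

Lemma Psi_exists (y : Yabc) : exists x : X3 L,
  forall v, v \in val (val y) -> Psi v \in val (val x).
Proof.
have [v vy v0] := PP_vec (val y).
have Pv0 : Psi v != 0 by apply: contra_neq v0; exact: (Psi_eq0 LM (Y_Ycone vy)).
have [x vx] := PP_of_vec Pv0.
have PsiP w : w \in val (val y) -> Psi w \in val x.
  by move=> /(PP_scale vy v0)[k ->]; rewrite PsiZ memvZ.
have Xx : X3_set L x.
  have /X3_setP E : forall w, w \in val x -> forall j, w ord0 (rgt j) ^+ 2 =
      (base w *m L) ord0 (evn j) * (base w *m L) ord0 (odn j).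
    (* Since [Psi] is quadratic, the scalar [k] is absorbed into the vector as a square root, and
       only vectors in the image of [Psi] remain to be checked. *)
    move=> w /(PP_scale vx Pv0)[k ->] j; rewrite -[k]sqrtCK -PsiZ.
    rewrite (base_PsiL LM) ?Psi_rgt ?[squares _ _ _]mxE ?exprMn //.
    by apply: (@Y_Ycone y); exact: memvZ.
  exact: E.
by exists (SigSub (mem_set Xx)).
Qed.

Section Covering.
Variable P : Yabc -> X3 L.
Hypothesis PE : forall (y : Yabc) v, v \in val (val y) -> Psi v \in val (val (P y)).

Lemma Psi_neq0 (y : Yabc) v : v \in val (val y) -> v != 0 -> Psi v != 0.
Proof. by move=> vy; apply: contra_neq; exact: (Psi_eq0 LM (Y_Ycone vy)). Qed.

Lemma covering_eq (y : Yabc) (x : X3 L) v : v \in val (val y) -> v != 0 ->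
  Psi v \in val (val x) -> P y = x.
Proof.
by move=> vy v0 vx; apply: val_inj; exact: PP_eq (PE vy) vx (Psi_neq0 vy v0).
Qed.

Lemma covering_morphism : morphism P.
Proof.
move=> W [A [E hE ->] WE]; rewrite setTI.
have vanE p (y : Yabc) : homogeneous p ->
    vanishes_at (pull M p) (val y) <-> vanishes_at p (val (P y)).
  move=> [d hp]; have [v vy v0] := PP_vec (val y); split=> van.
    apply: (vanishes_at_vec hp (PE vy) (Psi_neq0 vy v0)).
    by rewrite -pull_meval; exact: van.
  by move=> w wy; rewrite pull_meval; apply/van/PE.
have closedE (F : set {mpoly K[6]}) (y : Yabc) : (forall p, F p -> homogeneous p) ->
    zero_locus (pull M @` F) (val y) <-> zero_locus F (val (P y)).
  move=> hF; split=> [zy p Fp|zy _ [p Fp <-]].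
    by apply/(vanE p y (hF p Fp))/zy; exists p.
  by apply/(vanE p y (hF p Fp))/zy.
have closed_pull (F : set {mpoly K[6]}) : (forall p, F p -> homogeneous p) ->
    Zariski_closed (zero_locus (pull M @` F)).
  move=> hF; exists (pull M @` F) => // _ [p /hF[d hp] <-].
  by exists (d * 2)%N; exact: pull_homog.
split.
  exists (zero_locus (pull M @` E)); first exact: closed_pull.
  by move=> y; rewrite closedE // -WE.
move=> s rs y Wy; have [B [d [p [q [[F hF ->] Bx hp hq pq]]]]] := rs _ Wy.
exists (zero_locus (pull M @` F)), (d * 2)%N, (pull M p), (pull M q); split.
- exact: closed_pull.
- by rewrite closedE.
- exact: pull_homog.
- exact: pull_homog.
move=> y' Wy' Fy' v vy' v0; rewrite !pull_meval; apply: pq => //.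
- by rewrite -closedE.
- exact: PE.
- exact: Psi_neq0 vy' v0.
Qed.

Lemma covering_surjective x : exists y, P y = x.
Proof.
have [w wx w0] := PP_vec (val x); have /X3_setP/(_ w wx) Xw := set_valP x.
pose l i := (base w *m L) ord0 i.
(* The pair [st] consists of square roots of two paired linear forms, with prescribed product
   [w ord0 (rgt j)]. If the first form vanishes, so does the product, and any root of the second
   will do; otherwise the second root is obtained by division. *)
have /boolp.choice[st stE] (j : 'I_3) : exists st : K * K,
    [/\ st.1 ^+ 2 = l (evn j), st.2 ^+ 2 = l (odn j)
      & st.1 * st.2 = w ord0 (rgt j)].
  have [l0|l0] := eqVneq (l (evn j)) 0.
    exists (0, sqrtC (l (odn j))); rewrite /= sqrtCK expr0n l0 mul0r; split=> //.
    have := Xw j; rewrite -[_ (evn j)]/(l _) l0 mul0r => /eqP.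
    by rewrite expf_eq0 => /eqP.
  exists (sqrtC (l (evn j)), w ord0 (rgt j) / sqrtC (l (evn j))) => /=.
  have s0 : sqrtC (l (evn j)) != 0 by rewrite sqrtC_eq0.
  by rewrite expr_div_n !sqrtCK Xw -!/(l _) mulrC mulKf // mulrC divfK.
pose v : 'rV[K]_6 :=
  \row_i (if odd i then (st (inord i./2)).2 else (st (inord i./2)).1).
have ve j : v ord0 (evn j) = (st j).1.
  by rewrite mxE evnE odd_double doubleK inord_val.
have vo j : v ord0 (odn j) = (st j).2.
  by rewrite mxE odnE /= odd_double /= uphalf_double inord_val.
have vL : squares v = base w *m L.
  by apply/rowP; apply: ord6_ind => j; rewrite mxE ?ve ?vo; have [] := stE j.
have vw : Psi v = w.
  apply/rowP; apply: ord6_lr => j.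
    by rewrite Psi_lft vL -mulmxA LM mulmx1 mxE.
  by rewrite Psi_rgt ve vo; have [] := stE j.
have v0 : v != 0.
  apply: contra_neq w0 => v0; rewrite -vw v0.
  by have := PsiZ M 0 0; rewrite expr0n !scale0r.
have [y vy] := PP_of_vec v0.
have Yy : Y_set a b c y.
  apply/Y_setP => u /(PP_scale vy v0)[k ->]; exists (k ^+ 2 *: base w).
  by rewrite -scalemxAl -vL; apply/rowP => i; rewrite !mxE exprMn.
exists (SigSub (mem_set Yy)); apply: (covering_eq (v := v)) => //.
by rewrite vw.
Qed.

Lemma iota_flip j (y : Yabc) v : v \in val (val y) ->
  flip j v \in val (val (Defs.iota (evn j) (odn j) y)).
Proof. exact: memv_img. Qed.

Lemma covering_iota j (y : Yabc) : P (Defs.iota (evn j) (odn j) y) = P y.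
Proof.
have [v vy v0] := PP_vec (val y); apply: esym.
by apply: (covering_eq vy v0); rewrite -(Psi_flip M j); apply/PE/iota_flip.
Qed.

Lemma iota_groupP g : @iota_group K a b c g <->
  g = id \/ exists j, g = @Defs.iota K a b c (evn j) (odn j).
Proof.
have [_ [[e0 e1 e2] [o0 o1 o2]]] := rgt_evn_odnE; split.
  move=> [[[->|->]|->]|->]; first by left.
  - by right; exists 0; rewrite e0 o0.
  - by right; exists 1; rewrite e1 o1.
  - by right; exists 2%:R; rewrite e2 o2.
case=> [->|[j ->]]; first by do 3!left.
move: j; apply: ord3P; first by rewrite e0 o0; left; left; right.
- by rewrite e1 o1; left; right.
- by rewrite e2 o2; right.
Qed.

(* After rescaling, two vectors with the same image under [Psi] differ by a
   common sign on each pair of coordinates; [-1] acts trivially on points. *)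
Lemma Psi_fiber v v' : Ycone v -> Ycone v' -> Psi v = Psi v' ->
  (v = v' \/ v = - v') \/ exists j, v = flip j v' \/ v = - flip j v'.
Proof.
move=> Yv Yv' vv'.
have sq i : v ord0 i ^+ 2 = v' ord0 i ^+ 2.
  have := base_PsiL LM Yv; rewrite vv' (base_PsiL LM Yv') => /rowP/(_ i).
  by rewrite !mxE.
(* The sign is read off the first coordinate of the pair if that is nonzero, and the equal products
   then fix the second; otherwise it is read off the second. *)
have /boolp.choice[e eE] (j : 'I_3) : exists e : bool,
    v ord0 (evn j) = (-1) ^+ e * v' ord0 (evn j) /\
    v ord0 (odn j) = (-1) ^+ e * v' ord0 (odn j).
  have /rowP/(_ (rgt j)) := vv'; rewrite !Psi_rgt => pr.
  have /eqP := sq (evn j); rewrite eqf_sqr => /orP ev.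
  have /eqP := sq (odn j); rewrite eqf_sqr => /orP ov.
  have [z|nz] := eqVneq (v' ord0 (evn j)) 0.
    have -> : v ord0 (evn j) = 0 by case: ev => /eqP ->; rewrite z ?oppr0.
    rewrite z; case: ov => /eqP ->; first by exists false; rewrite !mul1r.
    by exists true; rewrite !mulN1r oppr0.
  case: ev pr => /eqP ->.
    by move=> /(mulfI nz) ->; exists false; rewrite !mul1r.
  rewrite mulNr -mulrN => /(mulfI nz)/eqP; rewrite eqr_oppLR => /eqP ->.
  by exists true; rewrite !mulN1r.
have vE (u : 'rV[K]_6) (t : 'I_3 -> bool) (s : bool) :
    (forall j, u ord0 (evn j) = (-1) ^+ t j * v' ord0 (evn j)) ->
    (forall j, u ord0 (odn j) = (-1) ^+ t j * v' ord0 (odn j)) ->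
    (forall j, e j = s (+) t j) -> v = u \/ v = - u.
  move=> ue uo est.
  have -> : v = (-1) ^+ s *: u.
    by apply/rowP; apply: ord6_ind => j; have [ej oj] := eE j;
      rewrite mxE ?ej ?oj ?ue ?uo mulrA -signr_addb est.
  by case: s {est}; [right; rewrite scaleN1r|left; rewrite scale1r].
have [s [es|[k es]]] : exists s, (forall j, e j = s (+) false) \/
    exists k, forall j, e j = s (+) (j == k :> 'I_3).
(* [s] is the majority value of the three signs; at most one of them differs from it. *)
- pose s := (e 0 && e 1) || (e 0 && e 2%:R) || (e 1 && e 2%:R); exists s.
  rewrite /s; case e0: (e 0); case e1: (e 1); case e2: (e 2%:R); by
    [left; apply: ord3P; rewrite ?e0 ?e1 ?e2
    |right; exists 0; apply: ord3P; rewrite ?e0 ?e1 ?e2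
    |right; exists 1; apply: ord3P; rewrite ?e0 ?e1 ?e2
    |right; exists 2%:R; apply: ord3P; rewrite ?e0 ?e1 ?e2].
- by left; apply: (vE _ (fun=> false) s) => // j; rewrite mul1r.
- right; exists k; apply: (vE _ (eq_op^~ k) s) => // j; first exact: flip_evn.
  exact: flip_odn.
Qed.

Lemma covering_orbit (y : Yabc) :
  orbit_of (@iota_group K a b c) y = [set z | P z = P y].
Proof.
rewrite predeqE => z /=; split.
  move=> [g /iota_groupP[->|[j ->]] <-]; [by []|exact: covering_iota].
move=> Pzy; have [v vz v0] := PP_vec (val z); have [u uy u0] := PP_vec (val y).
have := PE vz; rewrite Pzy => /(PP_scale (PE uy) (Psi_neq0 uy u0))[k].
rewrite -[k]sqrtCK -PsiZ; set u' := _ *: u => vu'.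
have u'y : u' \in val (val y) by exact: memvZ.
have mem_eq w : v = w \/ v = - w -> forall y' : Yabc, w \in val (val y') -> y' = z.
  move=> vw y' wy'; apply: val_inj.
  by apply: (PP_eq _ vz v0); case: vw => ->; rewrite ?memvN.
have [vE|[j vE]] := Psi_fiber (Y_Ycone vz) (Y_Ycone u'y) vu'.
  by exists id; [apply/iota_groupP; left|exact: mem_eq vE _ _].
exists (Defs.iota (evn j) (odn j)); first by apply/iota_groupP; right; exists j.
by apply: mem_eq vE _ _; exact: iota_flip.
Qed.

(** Common core of the descent of open sets and of regular functions. The relation is free of
    division, so [q] may vanish away from [v0], and [U] is an arbitrary subset. *)
Lemma covering_fraction (U : set (X3 L)) (s : X3 L -> K) d p q
    (y0 : Yabc) v0 :
  p \is d.-homog -> q \is d.-homog -> v0 \in val (val y0) -> q.@[v0 ord0] != 0 ->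
  (forall (y : Yabc) v, U (P y) -> v \in val (val y) -> v != 0 ->
     s (P y) * q.@[v ord0] = p.@[v ord0]) ->
  exists g h : {mpoly K[6]}, [/\ g \is d.-homog, h \is d.-homog,
    h.@[Psi v0 ord0] != 0 &
    forall x w, U x -> w \in val (val x) -> w != 0 ->
      s x * h.@[w ord0] = g.@[w ord0]].
Proof.
move=> hp hq vy0 q0 spq.
pose D v := exists y : Yabc, [/\ U (P y), v \in val (val y) & v != 0].
(* [t] lifts [s] to vectors, with default [0] at zero and outside the cone over Y. It is well
   defined because a nonzero vector lies on a single point. *)
have /boolp.choice[t tE] v : exists k, forall y : Yabc,
    v \in val (val y) -> v != 0 -> k = s (P y).
  have [[y [vy v_neq0]]|no] :=
    pselect (exists y : Yabc, v \in val (val y) /\ v != 0).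
    by exists (s (P y)) => y' vy' _; rewrite (covering_eq vy' v_neq0 (PE vy)).
  by exists 0 => y vy v_neq0; case: no; exists y.
have flip_neq0 j v : v != 0 -> flip j v != 0.
  apply: contra_neq => fv.
  by rewrite -(sign_change_linK (evn j) (odn j) v) -/(flip j v) fv linear0.
have [||||||g [h [hg hh h0 sgh]]] :=
  @invariant_fraction K L M LM D t _ _ _ d p q v0 hp hq.
- by move=> v [y [_ vy _]]; exact: Y_Ycone vy.
- move=> j v [y [Uy vy v_neq0]]; exists (Defs.iota (evn j) (odn j) y).
  by split; [rewrite covering_iota|exact: iota_flip|exact: flip_neq0].
- move=> j v [y [Uy vy v_neq0]].
  rewrite (tE _ _ (iota_flip j vy) (flip_neq0 j _ v_neq0)) covering_iota.
  by rewrite -(tE _ _ vy).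
- by move=> v [y [Uy vy v_neq0]]; rewrite (tE _ _ vy) // spq.
- exact: Y_Ycone vy0.
- exact: q0.
exists g, h; split=> // x w Ux wx w0.
have [y Py] := covering_surjective x; subst x.
have [v vy v_neq0] := PP_vec (val y).
have [k kE] := PP_scale (PE vy) (Psi_neq0 vy v_neq0) wx; rewrite kE.
rewrite (meval_homogZ _ _ hg) (meval_homogZ _ _ hh) mulrCA; congr (_ * _).
by rewrite -(tE _ _ vy) // sgh //; exists y.
Qed.

Lemma covering_open (U : set (X3 L)) : opens (P @^-1` U) -> opens U.
Proof.
move=> [_ [E hE ->] UE].
(* The zero locus of [F] is the closure of the complement of [U]; what must be found, at every point
   of [U], is a form of [F] that does not vanish there. *)
pose F := [set h : {mpoly K[6]} | homogeneous h /\
  forall x : X3 L, ~ U x -> vanishes_at h (val x)].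
exists (zero_locus F); first by exists F => // p [].
move=> x; split=> [Ux zx|nzx]; last first.
  by apply: contrapT => nUx; apply: nzx => h [_]; exact.
have [y Py] := covering_surjective x; subst x.
have [q Eq nq] : exists2 q, E q & ~ vanishes_at q (val y).
  have /UE/= nE := Ux; apply: contrapT => no; apply: nE => q Eq.
  by apply: contrapT => nq; apply: no; exists q.
have [v vy v0] := PP_vec (val y); have [d hq] := hE _ Eq.
have q0 := meval_neq0 hq vy v0 nq.
(* The indicator of [P y] on the union of [P y] and the complement of [U] is
   [q / q], so its numerator after descent vanishes off [U] but not at [P y]. *)
pose ind (x : X3 L) : K := `[< x = P y >]%:R.
have [|g [h [hg _ h0 gh]]] :=
  @covering_fraction (~` U `|` [set P y]) ind d q q y v hq hq vy q0.
  move=> y' w U'y' wy' _; rewrite /ind; case: asboolP => [_|neq].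
    by rewrite mul1r.
  have zE : zero_locus E (val y') by case: U'y' => // nU; apply: contrapT => /UE.
  by rewrite (zE _ Eq _ wy') mulr0.
have := gh (P y) (Psi v) (or_intror erefl) (PE vy) (Psi_neq0 vy v0).
rewrite /ind asboolT // mul1r => hgE; move: h0; rewrite hgE => /eqP; apply.
have Fg : F g.
  split=> [|x nUx]; first by exists d.
  have [w wx w0] := PP_vec (val x); apply: (vanishes_at_vec hg wx w0).
  rewrite -(gh x w (or_introl nUx) wx w0) /ind asboolF ?mul0r // => xE.
  by apply: nUx; rewrite xE.
exact: zx Fg _ (PE vy).
Qed.

Lemma covering_regular (U : set (X3 L)) s :
  regular (P @^-1` U) (s \o P) -> regular U s.
Proof.
move=> rs x Ux; have [y Py] := covering_surjective x; subst x.
have [_ [d [p [q [[E hE ->] nE hp hq spq]]]]] := rs y Ux.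
(* [r] is an equation of the excluded closed set that is nonzero at [y]. Multiplying numerator and
   denominator by [r] extends the relation to the whole preimage of [U], as both sides vanish where
   [r] does. *)
have [r Er nr] : exists2 r, E r & ~ vanishes_at r (val y).
  apply: contrapT => no; apply: nE => r Er.
  by apply: contrapT => nr; apply: no; exists r.
have [v vy v0] := PP_vec (val y); have [e hr] := hE _ Er.
have [q0 _] := spq _ Ux nE v vy v0.
have qr0 : (q * r).@[v ord0] != 0.
  by rewrite mevalM mulf_neq0 // (meval_neq0 hr vy v0).
have [|g [h [hg hh h0 sgh]]] := @covering_fraction U s (d + e) (p * r) (q * r) y v
    (dhomogM hp hr) (dhomogM hq hr) vy qr0.
  move=> y' w Uy' wy' w0; rewrite !mevalM.
  have [->|rw] := eqVneq (r.@[w ord0]) 0; first by rewrite !mulr0.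
  have [|qw /= ->] := spq _ Uy' _ w wy' w0.
    by move=> /(_ _ Er w wy') rw0; rewrite rw0 eqxx in rw.
  by rewrite mulrA divfK.
exists (zero_locus [set h]), (d + e)%N, g, h; split=> //.
- by exists [set h] => // _ ->; exists (d + e)%N.
- by move=> /(_ h erefl _ (PE vy)) h0'; rewrite h0' eqxx in h0.
move=> x' Ux' nh w wx' w0; have hw : h.@[w ord0] != 0.
  by apply: (meval_neq0 hh wx' w0) => van; apply: nh => _ ->.
by rewrite -(sgh x' w) // mulfK.
Qed.

End Covering.

Lemma Y_quotient_isomorphic_X3 : isomorphic (Y_quotient a b c) (X3 L).
Proof.
have [P PE] := boolp.choice Psi_exists.
apply: (quotient_isomorphic (covering_morphism PE)).
- exact: covering_surjective.
- exact: covering_orbit.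
- exact: covering_open.
- exact: covering_regular.
Qed.

End QuotientIsX3.

(** * Injectivity of [L] and comparison of the minimal resolutions *)

(** A nonzero vector killed by [L] would give a point on all six lines. *)
Lemma no_triple_points_row_free (K : closedFieldType) (L : 'M[K]_(3, 6)) :
  no_triple_points L -> row_free L.
Proof.
move=> noL; apply: inj_row_free => u uL0; apply: contrapT => /eqP u0.
have [x ux] := PP_of_vec u0.
have lx i : line L i x.
  by move=> w /(PP_scale ux u0)[k ->]; rewrite -scalemxAl uL0 !mxE mulr0.
have := noL 'o0 'o1 'o2 isT isT isT; rewrite predeqE => /(_ x)[+ _]; apply.
by split; first split; exact: lx.
Qed.

(** Existence is asserted beside the comparison with every minimal resolution, so that the latter is
    not vacuous. *)
Theorem proposition5p5 (R : realType) (L : 'M[R[i]]_(3, 6))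
    (a b c : 'rV[R[i]]_6) :
  triple_double_config L ->
  plane_equations L a b c ->
  forall (n : nat) (X : set (PP R[i] n)) (pi : proj_space X -> X3 L),
    minimal_resolution pi ->
    (exists (m : nat) (S : set (PP R[i] m))
            (rho : proj_space S -> Y_quotient a b c),
       minimal_resolution rho /\ isomorphic (proj_space X) (proj_space S)) /\
    (forall (m : nat) (S : set (PP R[i] m))
            (rho : proj_space S -> Y_quotient a b c),
       minimal_resolution rho -> isomorphic (proj_space X) (proj_space S)).
Proof.
move=> [_ noL _] Labc n X pi minpi.
have /row_freeP[M LM] := no_triple_points_row_free noL.
have [psi [phi [mpsi mphi psiK phiK]]] := Y_quotient_isomorphic_X3 LM Labc.
(* [phi] goes from X_3 to the quotient, so [X] itself, with [phi \o pi], is a minimal resolution of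
   the quotient. *)
have minphi := minimal_resolution_iso mphi mpsi phiK psiK minpi.
split=> [|m S rho minrho].
  by exists n, X, (phi \o pi); split=> //; exact: isomorphic_refl.
exact: minimal_resolution_unique minphi minrho.
Qed.
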